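(* There is no $\mathbf{\Sigma}^1_1$ (analytic) inextendible linearly ordered tower.
   Context: For $x,y\in[\omega]^\omega$, $y\subseteq^* x$ means $y\setminus x$ is finite. A set $X\subseteq[\omega]^\omega$ is an inextendible linearly ordered tower (ilt) if it is linearly ordered by $\subseteq^*$ and has no pseudointersection, i.e. there is no infinite $z\subseteq\omega$ with $z\subseteq^* x$ for all $x\in X$. *)

(* Defs.v *)
From HB Require Import structures.
From mathcomp Require Import all_boot all_order all_algebra.
From mathcomp Require Import all_classical all_reals all_analysis.

Set Implicit Arguments.
Unset Strict Implicit.
Unset Printing Implicit Defensive.

Local Open Scope classical_set_scope.

Definition almost_subset (y x : set nat) : Prop := finite_set (y `\` x).

Notation "y `<=*` x" := (almost_subset y x)
  (at level 70, no associativity) : classical_set_scope.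

(* [omega]^omega *)
Definition infinite_subsets : set (set nat) := [set x | infinite_set x].

Definition pseudointersection (X : set (set nat)) (z : set nat) : Prop :=
  infinite_subsets z /\ forall x, X x -> z `<=*` x.

(* [`<=*`] is only a preorder: "linearly ordered" means that any two members
   are comparable, that is, linearly ordered modulo finite differences. *)
Definition almost_linearly_ordered (X : set (set nat)) : Prop :=
  forall x y, X x -> X y -> x `<=*` y \/ y `<=*` x.

Definition ilt (X : set (set nat)) : Prop :=
  [/\ X `<=` infinite_subsets,
      almost_linearly_ordered X &
      ~ exists z, pseudointersection X z].

Definition baire_space : Type := prod_topology (fun _ : nat => nat).

HB.instance Definition _ := Pointed.on baire_space.
HB.instance Definition _ := Topological.on baire_space.

(* Boldface Sigma^1_1: projection along Baire space of a closed set. This is the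
   usual notion of analytic set when [T] is Polish. *)
Definition analytic (T : topologicalType) (A : set T) : Prop :=
  exists2 C : set (T * baire_space), closed C & A = fst @` C.

Definition subset_of_char (c : cantor_space) : set nat := [set n | c n].

(* A family of subsets of omega is analytic when the corresponding set of
   characteristic functions is analytic in Cantor space. As [omega]^omega is
   G_delta there, for families of infinite sets this is the same as being
   analytic in the subspace [omega]^omega. *)
Definition analytic_family (X : set (set nat)) : Prop :=
  analytic (subset_of_char @^-1` X).

(* Main.v *)
Require Import Defs.
From mathcomp Require Import all_boot all_order all_algebra.
From mathcomp Require Import all_classical all_reals all_analysis.

Local Open Scope classical_set_scope.

(** Suppose [X], the projection of a closed set [C], is linearly ordered without
    pseudointersection. Then no countable subset of [X] is coinitial. Call a
    finite sequence good if the members of [X] that have a witness in [C]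
    extending it are coinitial in [X]. A member of [X] lying strictly below
    countably many bounds, one for each bad sequence, has all prefixes of its
    witnesses good, and such members are coinitial below every good sequence.
    Extending two good sequences alternately then yields two points of the
    closed set [C] whose projections are incomparable. *)

(** * Almost inclusion and countable linearly ordered families *)

Lemma finite_set_natP (A : set nat) :
  finite_set A <-> exists n, forall k, A k -> k < n.
Proof.
split=> [/finite_seqP [s ->]|[n An]].
  by exists (\max_(i <- s) i).+1 => k /= ks; rewrite ltnS; exact: leq_bigmax_seq.
by apply: (@sub_finite_set _ _ `I_n) => //; exact: finite_II.
Qed.

Lemma almost_subsetP (y x : set nat) :
  y `<=*` x <-> exists n, forall k, n <= k -> y k -> x k.
Proof.
rewrite /almost_subset finite_set_natP; split=> -[n yx]; exists n => k.
  by move=> nk yk; apply: contrapT => xk; have := yx k (conj yk xk); rewrite ltnNge nk.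
by move=> [yk xk]; rewrite ltnNge; apply/negP => nk; apply: xk; exact: yx.
Qed.

Lemma not_almost_subset (y x : set nat) n :
  ~ y `<=*` x -> exists k, [/\ n <= k, y k & ~ x k].
Proof.
move=> yx; apply: contrapT => nk; apply: yx; apply/almost_subsetP.
by exists n => k kn yk; apply: contrapT => xk; apply: nk; exists k.
Qed.

Lemma almost_subset_refl (x : set nat) : x `<=*` x.
Proof. by apply/almost_subsetP; exists 0. Qed.

Lemma almost_subset_trans (y x z : set nat) :
  x `<=*` y -> y `<=*` z -> x `<=*` z.
Proof.
move=> /almost_subsetP[m xy] /almost_subsetP[n yz]; apply/almost_subsetP.
by exists (maxn m n) => k; rewrite geq_max => /andP[mk nk] /(xy _ mk)/(yz _ nk).
Qed.

(** Diagonalisation: among [u 0], ..., [u n] linearity gives an almost least set, which is infinite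
    and so meets all of them in a common point [f n >= n]. The range of [f] is then infinite and
    lies in each [u i] up to the values [f n] with [n < i]. *)
Lemma linear_seq_pseudointersection (u : nat -> set nat) :
  range u `<=` infinite_subsets -> almost_linearly_ordered (range u) ->
  exists z, pseudointersection (range u) z.
Proof.
move=> u_inf u_lin.
have u_min n : exists j, forall i, i <= n -> u j `<=*` u i.
  elim: n => [|n [j IH]].
    by exists 0 => i; rewrite leqn0 => /eqP ->; exact: almost_subset_refl.
  have [uj|uj] := u_lin (u j) (u n.+1) (imageT _ _) (imageT _ _).
    by exists j => i; rewrite leq_eqVlt => /predU1P[->//|]; exact: IH.
  exists n.+1 => i; rewrite leq_eqVlt => /predU1P[->|]; first exact: almost_subset_refl.
  by move=> /IH; exact: almost_subset_trans.
have u_meet n : exists k, n <= k /\ forall i, i <= n -> u i k.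
  have [j uj] := u_min n.
  (* The maximum of the finitely many thresholds works for all [i <= n] at once; for larger [i] the
     threshold is a dummy 0. *)
  have [N uN] : exists N, forall i k, i <= n -> N <= k -> u j k -> u i k.
    have : forall i, exists N, i <= n -> forall k, N <= k -> u j k -> u i k.
      move=> i; case: (leqP i n) => [/uj/almost_subsetP[N uN]|]; first by exists N.
      by exists 0.
    move=> /choice[N uN]; exists (\max_(i < n.+1) N i) => i k ilen Nk.
    apply: uN => //; apply: leq_trans Nk.
    exact: (@leq_bigmax _ (fun i : 'I_n.+1 => N i) (Ordinal (ilen : i < n.+1))).
  have [k ujk kN] : exists2 k, u j k & maxn n N <= k.
    apply: contrapT => nk; apply: (u_inf (u j) (imageT _ _)); apply/finite_set_natP.
    exists (maxn n N) => k ujk; rewrite ltnNge; apply/negP => Nk.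
    by apply: nk; exists k.
  by move: kN; rewrite geq_max => /andP[nk Nk]; exists k; split=> // i ?; exact: uN.
have [f fP] := choice u_meet.
exists (range f); split.
  move=> /finite_set_natP[n fn]; have := fn _ (imageT f n).
  by rewrite ltnNge (fP n).1.
move=> _ [i _ <-]; apply: (@sub_finite_set _ _ (f @` `I_i)).
  move=> _ [[n _ <-] ufn]; exists n => //=; rewrite ltnNge; apply/negP => ni.
  exact/ufn/(fP n).2.
exact/finite_image/finite_II.
Qed.

(** * Prefixes and limits of stabilising sequences *)

Lemma cvg_prod_eventually_eq (T : nat -> topologicalType)
    (u : nat -> prod_topology T) (l : prod_topology T) :
  (forall i, \forall n \near \oo, u n i = l i) -> u @ \oo --> l.
Proof.
move=> ul; apply/cvg_sup => i A [_ [[B oB <-] /= Bl BA]].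
by rewrite nbhs_filterE; apply: filterS (ul i) => n /= uln; apply: BA; rewrite /= uln.
Qed.

(** Both coordinates are recorded together in a countable type, so that one bound can later be
    chosen for each bad sequence. *)
Definition prefix_upto (m : nat) (p : cantor_space * baire_space) :
  seq (bool * nat) := [seq (p.1 i, p.2 i) | i <- iota 0 m].

Lemma prefix_uptoP m p q :
  prefix_upto m p = prefix_upto m q <->
  forall i, i < m -> p.1 i = q.1 i /\ p.2 i = q.2 i.
Proof.
split=> [/eq_in_map pq i im|pq].
  by have := pq i; rewrite mem_iota /= add0n => /(_ im)[].
by apply/eq_in_map => i; rewrite mem_iota /= add0n => /pq[-> ->].
Qed.

Lemma size_prefix_upto m p : size (prefix_upto m p) = m.
Proof. by rewrite size_map size_iota. Qed.

(** Since [m n >= n], every coordinate of [P n] is eventually constant; hence [P] converges in the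
    product, and closedness puts the limit in [C]. *)
Lemma closed_fusion (C : set (cantor_space * baire_space))
    (P : nat -> cantor_space * baire_space) (m : nat -> nat) :
  closed C -> (forall n, C (P n)) -> (forall n, m n < m n.+1) ->
  (forall n, prefix_upto (m n) (P n.+1) = prefix_upto (m n) (P n)) ->
  exists2 p, C p & forall n, prefix_upto (m n) p = prefix_upto (m n) (P n).
Proof.
move=> Ccl CP m_lt PS.
have m_le a b : a <= b -> m a <= m b.
  by apply: (@homo_leq _ m leq) => [//|x y z|n]; [exact: leq_trans|exact/ltnW].
have m_ge n : n <= m n by elim: n => // n /leq_ltn_trans; apply.
have P_agree a b i : a <= b -> i < m a ->
    (P b).1 i = (P a).1 i /\ (P b).2 i = (P a).2 i.
  move=> + ia; elim: b => [|b IH]; first by rewrite leqn0 => /eqP ->.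
  rewrite leq_eqVlt => /predU1P[->//|]; rewrite ltnS => ab.
  have [<- <-] := IH ab; have /prefix_uptoP := PS b.
  by apply; exact: leq_trans (m_le _ _ ab).
(* Coordinate [i] is read off [P i.+1], where it is already frozen because [i < m i.+1]. *)
pose c : cantor_space := fun i => (P i.+1).1 i.
pose f : baire_space := fun i => (P i.+1).2 i.
have Pcf n i : i < m n -> c i = (P n).1 i /\ f i = (P n).2 i.
  move=> im; have [ni|/ltnW ni] := leqP i.+1 n.
    by have [-> ->] := P_agree _ _ i ni (m_ge i.+1).
  exact: (P_agree n i.+1).
exists (c, f); last by move=> n; apply/prefix_uptoP; exact: Pcf.
have Pcvg : P n @[n --> \oo] --> (c, f).
  have -> : P = fun n => ((P n).1, (P n).2) by apply/funext => n; case: (P n).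
  have Pc : (P n).1 @[n --> \oo] --> c.
    apply: cvg_prod_eventually_eq => i; exists i.+1 => // n /= ni.
    by have [-> _] := Pcf n i (leq_trans ni (m_ge n)).
  have Pf : (P n).2 @[n --> \oo] --> f.
    apply: cvg_prod_eventually_eq => i; exists i.+1 => // n /= ni.
    by have [_ ->] := Pcf n i (leq_trans ni (m_ge n)).
  exact: (cvg_pair Pc Pf).
by apply: closed_cvg Pcvg => //; exact: nearW.
Qed.

(** * Good sequences and two incomparable members *)

Section ClosedWitnesses.
Variables (X : set (set nat)) (C : set (cantor_space * baire_space)).
Hypothesis Ccl : closed C.
Hypothesis XC : subset_of_char @^-1` X = fst @` C.
Hypothesis X_inf : X `<=` infinite_subsets.
Hypothesis X_lin : almost_linearly_ordered X.
Hypothesis X_inext : ~ exists z, pseudointersection X z.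

Local Notation proj_set p := (subset_of_char p.1).

Lemma proj_mem p : C p -> X (proj_set p).
Proof. by move=> Cp; have : (fst @` C) p.1 by [exists p]; rewrite -XC. Qed.

Lemma mem_proj x : X x -> exists2 p, C p & proj_set p = x.
Proof.
pose c : cantor_space := fun n => `[< x n >].
have cx : subset_of_char c = x.
  by apply/seteqP; split=> n /=; [move/asboolP|move=> ?; apply/asboolP].
move=> Xx; have : (subset_of_char @^-1` X) c by rewrite /= cx.
by rewrite XC => -[p Cp pc]; exists p => //; rewrite pc.
Qed.

(** If no such [w] existed, the [u t] would be coinitial in [X], and a pseudointersection of these
    countably many sets would be one of [X]. By linearity, the conclusion means that [w] is strictly
    below every [u t]. *)
Lemma strictly_below_countable (T : countType) (u : T -> set nat) :
  (forall t, X (u t)) -> exists2 w, X w & forall t, ~ u t `<=*` w.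
Proof.
(* An empty [X] would have [setT] as a pseudointersection. The member [x0] fills the indices that
   code no element of [T]. *)
move=> Xu; have [x0 Xx0] : exists x, X x.
  apply: contrapT => X0; apply: X_inext; exists setT; split.
    exact: infinite_nat.
  by move=> x Xx; exfalso; apply: X0; exists x.
apply: contrapT => nw; apply: X_inext.
pose v n := oapp u x0 (unpickle n).
have Xv n : X (v n) by rewrite /v; case: unpickle.
have [|_ _ [m _ <-] [n _ <-]|z [z_inf zv]] := @linear_seq_pseudointersection v.
- by move=> _ [n _ <-]; exact: X_inf.
- exact: X_lin.
exists z; split=> // x Xx; apply: contrapT => zx; apply: nw; exists x => // t utx.
apply: zx; apply: almost_subset_trans utx; apply: zv.
by exists (pickle t) => //; rewrite /v pickleK.
Qed.

Definition good (s : seq (bool * nat)) : Prop := forall x, X x ->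
  exists p, [/\ C p, prefix_upto (size s) p = s & proj_set p `<=*` x].

Definition good_point (p : cantor_space * baire_space) : Prop :=
  C p /\ forall m, good (prefix_upto m p).

Lemma good_point_below s w : good s -> X w ->
  exists p, [/\ good_point p, prefix_upto (size s) p = s & proj_set p `<=*` w].
Proof.
move=> s_good Xw.
(* For bad [t], [x] is a member of [X] at which coinitiality fails; for good [t], [w] serves as a
   dummy. *)
have : forall t, exists x, X x /\ (~ good t -> forall p, C p ->
    prefix_upto (size t) p = t -> ~ proj_set p `<=*` x).
  move=> t; have [t_good|/existsNP[x /not_implyP[Xx t_bad]]] := pselect (good t).
    by exists w.
  by exists x; split=> // _ p Cp pt px; apply: t_bad; exists p.
move=> /choice[u uP].
(* The index [None] adds [w] itself to the bounds [u t]. *)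
have [|v Xv v_below] := @strictly_below_countable (option (seq (bool * nat))) (oapp u w).
  by case=> [t|//]; exact: (uP t).1.
have vw : v `<=*` w by have [//|/(v_below None)] := X_lin _ _ Xv Xw.
have vu t : v `<=*` u t.
  by have [//|/(v_below (Some t))] := X_lin _ _ Xv (uP t).1.
have [p [Cp ps pv]] := s_good v Xv.
exists p; split=> //; last exact: almost_subset_trans vw.
(* A bad prefix [t] of [p] would make [p] a witness extending [t] with projection almost below
   [u t], against the choice of [u t]. *)
split=> // m; apply: contrapT => /(uP _).2 /(_ p Cp); apply.
  by rewrite size_prefix_upto.
exact: almost_subset_trans (vu _).
Qed.

(** Goodness of the prefix of [q] allows its replacement by a good point projecting below some [w]
    strictly below the projection of [p]; the latter is then not almost contained in the new
    projection. *)
Lemma good_point_separate p q m : good_point p -> good_point q ->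
  exists q' k, [/\ good_point q', prefix_upto m q' = prefix_upto m q,
    m <= k, p.1 k & ~~ q'.1 k].
Proof.
move=> [Cp _] [_ /(_ m) q_good].
have [w Xw] := @strictly_below_countable unit (fun=> proj_set p)
  (fun=> proj_mem _ Cp).
move=> /(_ tt) pw; have [q' [gq' + q'w]] := good_point_below _ _ q_good Xw.
rewrite size_prefix_upto => q'q.
have [pq'|k [mk pk /negP q'k]] := @not_almost_subset (proj_set p) (proj_set q') m.
  by apply: pw; exact: almost_subset_trans q'w.
by exists q', k.
Qed.

Lemma not_linear_of_closed_witnesses : False.
Proof.
pose point := (cantor_space * baire_space)%type.
(* In a state [(p, q, m)] the first [m] coordinates of both points are frozen; a step puts a new
   disagreement in each direction below the next length. *)
pose good_state (t : point * point * nat) := good_point t.1.1 /\ good_point t.1.2.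
pose step (t t' : point * point * nat) := [/\ t.2 < t'.2,
  prefix_upto t.2 t'.1.1 = prefix_upto t.2 t.1.1,
  prefix_upto t.2 t'.1.2 = prefix_upto t.2 t.1.2,
  (exists k, [/\ t.2 <= k, k < t'.2, t'.1.1.1 k & ~~ t'.1.2.1 k]) &
  (exists k, [/\ t.2 <= k, k < t'.2, t'.1.2.1 k & ~~ t'.1.1.1 k])].
have : forall t, exists t', good_state t -> good_state t' /\ step t t'.
  move=> [[p q] m]; have [[gp gq]|] := pselect (good_state (p, q, m)); last first.
    by exists (p, q, m).
  have [q' [k [gq' q'q mk pk q'k]]] := good_point_separate p q m gp gq.
  (* Freezing [k.+1] coordinates of [p] keeps [k] in the projection of [p'], so the first
     disagreement survives. *)
  have [p' [l [gp' p'p kl q'l p'l]]] := good_point_separate q' p k.+1 gq' gp.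
  have /prefix_uptoP pp' := p'p.
  exists (p', q', l.+1) => _; split=> //; split=> //=.
  - by rewrite ltnS (leq_trans mk)// ltnW.
  - by apply/prefix_uptoP => i im; apply: pp'; rewrite ltnS (leq_trans (ltnW im)).
  - by exists k; split=> //; [exact: ltnW|rewrite (pp' k _).1].
  - by exists l; split=> //; rewrite (leq_trans mk)// ltnW.
move=> /choice[F FP].
(* With no bounds at all, this only provides a member of [X]. *)
have [w Xw _] := @strictly_below_countable void (fun=> setT) (fun v => match v with end).
have good_nil : good [::].
  move=> x /mem_proj[p Cp <-]; exists p; split=> //; exact: almost_subset_refl.
have [p0 [gp0 _ _]] := good_point_below _ _ good_nil Xw.
pose st n := iter n F (p0, p0, 0).
have st_good n : good_state (st n) by elim: n => [//|n /FP[]].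
have st_step n : step (st n) (st n.+1) by have [] := FP _ (st_good n).
pose m n := (st n).2.
have m_lt n : m n < m n.+1 by have [] := st_step n.
have m_ge n : n <= m n by elim: n => // n /leq_ltn_trans; apply.
have [p Cp pP] : exists2 p, C p &
    forall n, prefix_upto (m n) p = prefix_upto (m n) (st n).1.1.
  apply: closed_fusion => // n; first by have [[]] := st_good n.
  by have [] := st_step n.
have [q Cq qP] : exists2 q, C q &
    forall n, prefix_upto (m n) q = prefix_upto (m n) (st n).1.2.
  apply: closed_fusion => // n; first by have [_ []] := st_good n.
  by have [] := st_step n.
have pE n k : k < m n -> p.1 k = (st n).1.1.1 k.
  by move=> km; have /prefix_uptoP/(_ k km)[] := pP n.
have qE n k : k < m n -> q.1 k = (st n).1.2.1 k.
  by move=> km; have /prefix_uptoP/(_ k km)[] := qP n.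
(* An inclusion beyond [n] fails at the disagreement found in step [n]: it is at least [m n >= n],
   and below [m n.+1], where [p] and [q] agree with state [n.+1]. *)
have [/almost_subsetP[n]|/almost_subsetP[n]] := X_lin _ _ (proj_mem _ Cp) (proj_mem _ Cq).
  have [_ _ _ [k [mk km pk /negP qk]] _] := st_step n.
  move=> /(_ k (leq_trans (m_ge n) mk)); rewrite /subset_of_char /=.
  by rewrite (pE n.+1)// (qE n.+1)// => /(_ pk).
have [_ _ _ _ [k [mk km qk /negP pk]]] := st_step n.
move=> /(_ k (leq_trans (m_ge n) mk)); rewrite /subset_of_char /=.
by rewrite (pE n.+1)// (qE n.+1)// => /(_ qk).
Qed.

End ClosedWitnesses.

Theorem theorem2p5 : ~ exists X : set (set nat), analytic_family X /\ ilt X.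
Proof.
move=> [X [[C Ccl XC] [X_inf X_lin X_inext]]].
exact: (@not_linear_of_closed_witnesses X C).
Qed.
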